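(* Let $\mathfrak{g}$ be a finite-dimensional complex semisimple Lie algebra, and let $\mathbf{Crys}$ be the category of $U_q(\mathfrak{g})$-crystals. Then $\mathbf{Crys}$, with the tensor product of crystals as its tensor bifunctor $\otimes:\mathbf{Crys}\times\mathbf{Crys}\to\mathbf{Crys}$, has the structure of a monoidal category.
   Context: Let $\Pi$ be the set of simple roots of $\mathfrak{g}$ with respect to a fixed Cartan subalgebra $\mathfrak{h}$, let $(\cdot,\cdot)$ be the bilinear form on $\mathfrak{h}^*$ induced by the Killing form, and let $\Lambda=\bigoplus_{\alpha\in\Pi}\mathbb{Z}\omega_\alpha\subseteq\mathfrak{h}^*$ be the weight lattice, where the fundamental weights $\omega_\alpha$ satisfy $(\omega_\alpha,\beta)=\delta_{\alpha\beta}\frac{(\beta,\beta)}{2}$ for $\alpha,\beta\in\Pi$. For $\alpha\in\Pi$ put $\alpha^\vee=\frac{2}{(\alpha,\alpha)}\alpha$, so that $(\alpha^\vee,\lambda)\in\mathbb{Z}$ for $\lambda\in\Lambda$. In $\mathbb{Z}\sqcup\{-\infty\}$, $-\infty$ is smaller than every integer and $-\infty+n=-\infty$ for every integer $n$. A $U_q(\mathfrak{g})$-crystal (crystal for short) is a finite set $B$ with maps $\mathrm{wt}:B\to\Lambda$, and for each $\alpha\in\Pi$ maps $\varepsilon_\alpha,\varphi_\alpha:B\to\mathbb{Z}\sqcup\{-\infty\}$ and $\tilde E_\alpha,\tilde F_\alpha:B\to B\sqcup\{0\}$ (where $0$ is an extra element not in $B$), such that for all $b,b'\in B$ and $\alpha\in\Pi$: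 (1) $\varphi_\alpha(b)=\varepsilon_\alpha(b)+(\alpha^\vee,\mathrm{wt}(b))$; (2) $b'=\tilde F_\alpha b$ if and only if $b=\tilde E_\alpha b'$; (3) if $\varphi_\alpha(b)=-\infty$ then $\tilde E_\alpha b=\tilde F_\alpha b=0$; (4) if $\tilde E_\alpha b\neq 0$ then $\varepsilon_\alpha(\tilde E_\alpha b)=\varepsilon_\alpha(b)-1$, $\varphi_\alpha(\tilde E_\alpha b)=\varphi_\alpha(b)+1$, $\mathrm{wt}(\tilde E_\alpha b)=\mathrm{wt}(b)+\alpha$; (5) if $\tilde F_\alpha b\neq 0$ then $\varepsilon_\alpha(\tilde F_\alpha b)=\varepsilon_\alpha(b)+1$, $\varphi_\alpha(\tilde F_\alpha b)=\varphi_\alpha(b)-1$, $\mathrm{wt}(\tilde F_\alpha b)=\mathrm{wt}(b)-\alpha$. A morphism of crystals $\psi:B_1\to B_2$ is a map $\psi:B_1\sqcup\{0\}\to B_2\sqcup\{0\}$ with $\psi(0)=0$ such that for all $b\in B_1$ and $\alpha\in\Pi$: if $\psi(b)\neq 0$ then $\mathrm{wt}(\psi(b))=\mathrm{wt}(b)$, $\varepsilon_\alpha(\psi(b))=\varepsilon_\alpha(b)$, $\varphi_\alpha(\psi(b))=\varphi_\alpha(b)$; if $\psi(\tilde E_\alpha b)\neq 0$ and $\psi(b)\neq 0$ then $\psi(\tilde E_\alpha b)=\tilde E_\alpha\psi(b)$; if $\psi(\tilde F_\alpha b)\neq 0$ and $\psi(b)\neq 0$ then $\psi(\tilde F_\alpha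 b)=\tilde F_\alpha\psi(b)$. The category $\mathbf{Crys}$ has crystals as objects and these morphisms, composed as maps. The tensor product $B_1\otimes B_2$ of crystals is the set of symbols $\{b_1\otimes b_2\mid b_1\in B_1,b_2\in B_2\}$ (that is, $B_1\times B_2$), with the convention $b_1\otimes 0=0\otimes b_2=0$, and crystal structure $$\mathrm{wt}(b_1\otimes b_2)=\mathrm{wt}(b_1)+\mathrm{wt}(b_2),$$ $$\varepsilon_\alpha(b_1\otimes b_2)=\max\big(\varepsilon_\alpha(b_1),\ \varepsilon_\alpha(b_2)-(\alpha^\vee,\mathrm{wt}(b_1))\big),$$ $$\varphi_\alpha(b_1\otimes b_2)=\max\big(\varphi_\alpha(b_2),\ \varphi_\alpha(b_1)+(\alpha^\vee,\mathrm{wt}(b_2))\big),$$ $$\tilde E_\alpha(b_1\otimes b_2)=\begin{cases}\tilde E_\alpha b_1\otimes b_2 & \text{if }\varphi_\alpha(b_1)\geq\varepsilon_\alpha(b_2),\\ b_1\otimes\tilde E_\alpha b_2 & \text{if }\varphi_\alpha(b_1)<\varepsilon_\alpha(b_2),\end{cases}$$ $$\tilde F_\alpha(b_1\otimes b_2)=\begin{cases}\tilde F_\alpha b_1\otimes b_2 & \text{if }\varphi_\alpha(b_1)>\varepsilon_\alpha(b_2),\\ b_1\otimes\tilde F_\alpha b_2 & \text{if }\varphi_\alpha(b_1)\leq\varepsilon_\alpha(b_2).\end{cases}$$ On morphisms, $(\psi_1\otimes\psi_2)(b_1\otimes b_2)=\psi_1(b_1)\otimes\psi_2(b_2)$. A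 monoidal category structure consists of the bifunctor $\otimes$, a unit object $I$, natural isomorphisms $\alpha_{X,Y,Z}:(X\otimes Y)\otimes Z\to X\otimes(Y\otimes Z)$, $l_X:I\otimes X\to X$, $r_X:X\otimes I\to X$, satisfying the usual pentagon and triangle identities. *)

(* Defs.v *)
From HB Require Import structures.
From mathcomp Require Import all_boot all_order all_algebra finmap.
From mathcomp Require Import boolp classical_sets reals complex.
From mathcomp Require Import zify.

Set Implicit Arguments.
Unset Strict Implicit.
Unset Printing Implicit Defensive.

Import Order.TTheory GRing.Theory Num.Theory.
Local Open Scope ring_scope.

Record lieAlgebra (K : fieldType) := LieAlgebra {
  lie_sort :> vectType K;
  lie_br : lie_sort -> lie_sort -> lie_sort;
  lie_br_linearr : forall x, linear (lie_br x);
  lie_br_linearl : forall y, linear (lie_br^~ y);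
  lie_brxx : forall x, lie_br x x = 0;
  lie_jacobi : forall x y z,
    lie_br x (lie_br y z) + lie_br y (lie_br z x) + lie_br z (lie_br x y) = 0
}.
Arguments lie_br {K l}.

Section LieTheory.
Context (K : fieldType) (g : lieAlgebra K).
Implicit Types (U V : {vspace g}).

(* By bilinearity, spanned by the brackets of basis vectors. *)
Definition lie_brv U V : {vspace g} :=
  <<[seq lie_br u v | u <- vbasis U, v <- vbasis V]>>%VS.

Definition is_ideal U := forall x y, y \in U -> lie_br x y \in U.

Definition is_subalgebra U :=
  forall x y, x \in U -> y \in U -> lie_br x y \in U.

Definition is_solvable U := exists n, iter n (fun V => lie_brv V V) U = 0%VS.

Definition is_nilpotent U := exists n, iter n (lie_brv U) U = 0%VS.

Definition semisimple :=
  forall U, is_ideal U -> is_solvable U -> U = 0%VS.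

Definition is_cartan U :=
  [/\ is_subalgebra U, is_nilpotent U
    & forall x, (forall y, y \in U -> lie_br x y \in U) -> x \in U].

Definition ad (x : g) : 'End(g) := linfun (lie_br x).

Definition lftrace (V : vectType K) (f : 'End(V)) : K :=
  \tr (passmx.mxof (vbasis {:V}) (vbasis {:V}) f).

Definition killing (x y : g) : K := lftrace (ad x \o ad y)%VF.

End LieTheory.

Notation dual h := 'Hom(subvs_of h, _^o).

Section Roots.
Context (K : fieldType) (g : lieAlgebra K) (h : {vspace g}).
Implicit Types (l m : dual h).

Definition is_root l :=
  l != 0 /\ exists2 x : g, x != 0 & forall y : subvs_of h,
    lie_br (vsval y) x = (l y : K) *: x.

(* A set of simple roots is a base of the root system. *)
Definition is_simple_roots (Pi : {fset dual h}) :=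
  [/\ forall a : Pi, is_root (val a),
      basis_of fullv (enum_fset Pi)
    & forall b, is_root b -> exists n : Pi -> nat,
        b = \sum_(a : Pi) val a *+ n a \/ b = - \sum_(a : Pi) val a *+ n a].

Definition killing_flat : 'Hom(subvs_of h, dual h) :=
  linfun (fun x : subvs_of h => linfun (fun y : subvs_of h =>
    (killing (vsval x) (vsval y) : K^o))).

Definition form l m : K :=
  killing (vsval ((killing_flat^-1)%VF l)) (vsval ((killing_flat^-1)%VF m)).

Definition coroot l : dual h := (2%:R / form l l) *: l.

Definition is_fundamental_weights (Pi : {fset dual h}) (om : Pi -> dual h) :=
  forall a b : Pi,
    form (om a) (val b) = (a == b)%:R * (form (val b) (val b) / 2%:R).

Definition weight_lattice (Pi : {fset dual h}) (om : Pi -> dual h)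
  : set (dual h) :=
  [set l | exists n : Pi -> int, l = \sum_(a : Pi) om a *~ n a]%classic.

(* The integer [(a^\vee, l)]; meaningful when that scalar is integral and [K]
   has characteristic 0, in particular for [a] simple, [l] in the weight lattice
   and [K] the complex numbers. *)
Definition pairing (a l : dual h) : int :=
  xget 0 [set n : int | n%:~R = form (coroot a) l]%classic.

End Roots.

(* [None] is [-oo]. *)
Definition zinf := option int.

Definition zadd (x : zinf) (n : int) : zinf := omap (+%R^~ n) x.

Definition zle (x y : zinf) : bool :=
  match x, y with
  | None, _ => true
  | Some _, None => false
  | Some m, Some n => m <= n
  end.

Definition zlt (x y : zinf) : bool := ~~ zle y x.

Definition zmax (x y : zinf) : zinf := if zle x y then y else x.

Section Crystals.
Context (K : fieldType) (g : lieAlgebra K) (h : {vspace g}).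
Context (Pi : {fset dual h}) (om : Pi -> dual h).

(* The extra element [0] is the [None] of [option crys_sort]. *)
Record crystal := Crystal {
  crys_sort :> finType;
  wt : crys_sort -> dual h;
  eps : Pi -> crys_sort -> zinf;
  phi : Pi -> crys_sort -> zinf;
  cE : Pi -> crys_sort -> option crys_sort;
  cF : Pi -> crys_sort -> option crys_sort;
  wt_lattice : forall b, weight_lattice om (wt b);
  phiE : forall a b, phi a b = zadd (eps a b) (pairing (val a) (wt b));
  cFE : forall a b b', cF a b = Some b' <-> cE a b' = Some b;
  phi_infty : forall a b, phi a b = None -> cE a b = None /\ cF a b = None;
  cE_some : forall a b b', cE a b = Some b' ->
    [/\ eps a b' = zadd (eps a b) (-1), phi a b' = zadd (phi a b) 1
      & wt b' = wt b + val a];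
  cF_some : forall a b b', cF a b = Some b' ->
    [/\ eps a b' = zadd (eps a b) 1, phi a b' = zadd (phi a b) (-1)
      & wt b' = wt b - val a]
}.

Record is_crys_mor (B1 B2 : crystal) (f : option B1 -> option B2) : Prop :=
  IsCrysMor {
  mor0 : f None = None;
  mor_stat : forall b b', f (Some b) = Some b' ->
    wt b' = wt b /\ forall a, eps a b' = eps a b /\ phi a b' = phi a b;
  morE : forall a b, f (cE a b) <> None -> f (Some b) <> None ->
    f (cE a b) = obind (cE a) (f (Some b));
  morF : forall a b, f (cF a b) <> None -> f (Some b) <> None ->
    f (cF a b) = obind (cF a) (f (Some b))
}.

Record crys_mor (B1 B2 : crystal) := CrysMor {
  mor_fun :> option B1 -> option B2;
  morP : is_crys_mor mor_fun
}.

Lemma crys_mor_eq (B1 B2 : crystal) (f1 f2 : crys_mor B1 B2) :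
  f1 =1 f2 -> f1 = f2.
Proof.
case: f1 f2 => [f1 p1] [f2 p2] /= /funext e; case: _ / e p2 => p2.
by rewrite (Prop_irrelevance p1 p2).
Qed.

Lemma crys_id_subproof (B : crystal) : @is_crys_mor B B id.
Proof.
split=> //=.
by move=> b b' [->].
Qed.

Definition crys_id (B : crystal) : crys_mor B B :=
  CrysMor (crys_id_subproof B).

Lemma crys_comp_subproof (B1 B2 B3 : crystal)
    (f2 : crys_mor B2 B3) (f1 : crys_mor B1 B2) : is_crys_mor (f2 \o f1).
Proof.
have [z1 s1 e1 k1] := morP f1; have [z2 s2 e2 k2] := morP f2.
split=> /= [|b b'|a b|a b].
- by rewrite z1.
- case E1: (f1 (Some b)) => [c|]; last by rewrite z2.
  move=> /s2 [-> t2]; have [-> t1] := s1 _ _ E1; split=> // a.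
  by have [-> ->] := t2 a; have [-> ->] := t1 a.
- move=> H1 H2.
  have N1 : f1 (cE a b) <> None by move=> E1; rewrite E1 z2 in H1.
  have N2 : f1 (Some b) <> None by move=> E1; rewrite E1 z2 in H2.
  move: H1 H2; rewrite (e1 _ _ N1 N2); case: (f1 (Some b)) N2 => //= c _.
  exact: e2.
- move=> H1 H2.
  have N1 : f1 (cF a b) <> None by move=> E1; rewrite E1 z2 in H1.
  have N2 : f1 (Some b) <> None by move=> E1; rewrite E1 z2 in H2.
  move: H1 H2; rewrite (k1 _ _ N1 N2); case: (f1 (Some b)) N2 => //= c _.
  exact: k2.
Qed.

Definition crys_comp (B1 B2 B3 : crystal)
    (f2 : crys_mor B2 B3) (f1 : crys_mor B1 B2) : crys_mor B1 B3 :=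
  CrysMor (crys_comp_subproof f2 f1).

End Crystals.

Record category := Category {
  ob :> Type;
  hom : ob -> ob -> Type;
  idm : forall X, hom X X;
  comp : forall X Y Z, hom Y Z -> hom X Y -> hom X Z;
  comp1m : forall X Y (f : hom X Y), comp (idm Y) f = f;
  compm1 : forall X Y (f : hom X Y), comp f (idm X) = f;
  compA : forall W X Y Z (u : hom Y Z) (v : hom X Y) (w : hom W X),
    comp u (comp v w) = comp (comp u v) w
}.
Arguments hom {c}.
Arguments idm {c}.
Arguments comp {c X Y Z}.

Definition is_iso (C : category) (X Y : C) (f : hom X Y) :=
  exists2 f' : hom Y X, comp f' f = idm X & comp f f' = idm Y.

(* The bifunctor, given by its action on objects and on morphisms, is a parameter;
   that it is functorial is part of the structure. *)
Record monoidal_structure (C : category) (tob : C -> C -> C)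
    (thom : forall X X' Y Y' : C,
      hom X X' -> hom Y Y' -> hom (tob X Y) (tob X' Y')) := MonoidalStructure {
  tensor_id : forall X Y : C, thom _ _ _ _ (idm X) (idm Y) = idm (tob X Y);
  tensor_comp : forall (X X' X'' Y Y' Y'' : C)
      (u' : hom X' X'') (u : hom X X') (v' : hom Y' Y'') (v : hom Y Y'),
    thom _ _ _ _ (comp u' u) (comp v' v)
    = comp (thom _ _ _ _ u' v') (thom _ _ _ _ u v);
  unit_ob : C;
  assoc : forall X Y Z : C, hom (tob (tob X Y) Z) (tob X (tob Y Z));
  lunit : forall X : C, hom (tob unit_ob X) X;
  runit : forall X : C, hom (tob X unit_ob) X;
  assoc_iso : forall X Y Z, is_iso (assoc X Y Z);
  lunit_iso : forall X, is_iso (lunit X);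
  runit_iso : forall X, is_iso (runit X);
  assoc_nat : forall (X X' Y Y' Z Z' : C)
      (u : hom X X') (v : hom Y Y') (w : hom Z Z'),
    comp (assoc X' Y' Z') (thom _ _ _ _ (thom _ _ _ _ u v) w)
    = comp (thom _ _ _ _ u (thom _ _ _ _ v w)) (assoc X Y Z);
  lunit_nat : forall (X X' : C) (u : hom X X'),
    comp (lunit X') (thom _ _ _ _ (idm unit_ob) u) = comp u (lunit X);
  runit_nat : forall (X X' : C) (u : hom X X'),
    comp (runit X') (thom _ _ _ _ u (idm unit_ob)) = comp u (runit X);
  pentagon : forall W X Y Z : C,
    comp (assoc W X (tob Y Z)) (assoc (tob W X) Y Z)
    = comp (thom _ _ _ _ (idm W) (assoc X Y Z))
        (comp (assoc W (tob X Y) Z)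
          (thom _ _ _ _ (assoc W X Y) (idm Z)));
  triangle : forall X Y : C,
    comp (thom _ _ _ _ (idm X) (lunit Y)) (assoc X unit_ob Y)
    = thom _ _ _ _ (runit X) (idm Y)
}.

Section CrysCategory.
Context (K : fieldType) (g : lieAlgebra K) (h : {vspace g}).
Context (Pi : {fset dual h}) (om : Pi -> dual h).

Lemma crys_comp1m (B1 B2 : crystal om) (f : crys_mor B1 B2) :
  crys_comp (crys_id B2) f = f.
Proof. exact: crys_mor_eq. Qed.

Lemma crys_compm1 (B1 B2 : crystal om) (f : crys_mor B1 B2) :
  crys_comp f (crys_id B1) = f.
Proof. exact: crys_mor_eq. Qed.

Lemma crys_compA (B1 B2 B3 B4 : crystal om) (u : crys_mor B3 B4)
    (v : crys_mor B2 B3) (w : crys_mor B1 B2) :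
  crys_comp u (crys_comp v w) = crys_comp (crys_comp u v) w.
Proof. exact: crys_mor_eq. Qed.

Definition Crys : category :=
  @Category (crystal om) (@crys_mor _ _ _ _ om) (@crys_id _ _ _ _ om)
    (@crys_comp _ _ _ _ om) crys_comp1m crys_compm1 crys_compA.

End CrysCategory.

(* [b1 (x) b2], with [b1 (x) 0 = 0 (x) b2 = 0]. *)
Definition otens (T1 T2 : Type) (x : option T1) (y : option T2)
  : option (T1 * T2) :=
  match x, y with Some b1, Some b2 => Some (b1, b2) | _, _ => None end.
Arguments otens {T1 T2} !x !y : simpl nomatch.

Section FormTheory.
Context (K : fieldType) (g : lieAlgebra K) (h : {vspace g}).

Lemma linfunE (aT rT : vectType K) (f : aT -> rT) : linear f ->
  linfun f =1 f.
Proof.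
move=> lf.
pose fl := GRing.isLinear.Build _ _ _ _ f lf.
pose F : {linear aT -> rT} := HB.pack f fl.
exact: (lfunE F).
Qed.

Lemma ad_is_linear : linear (@ad K g).
Proof.
move=> c x y; apply/lfunP => z.
rewrite !lfunE /= !lfunE /= !linfunE; first exact: (lie_br_linearl z c x y).
all: exact: lie_br_linearr.
Qed.

Lemma killingC (x y : g) : killing x y = killing y x.
Proof.
rewrite /killing /lftrace.
by rewrite !(passmx.mxof_comp _ _ (vbasisP {:g})) mxtrace_mulC.
Qed.

Lemma killing_linearr (x : g) : linear (killing x : g -> K^o).
Proof.
move=> c y z; rewrite /killing ad_is_linear comp_lfunDr -comp_lfunZr.
by rewrite /lftrace passmx.mxof_linear mxtraceD mxtraceZ.
Qed.

Lemma formC (l m : dual h) : form l m = form m l.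
Proof. exact: killingC. Qed.

Lemma form_linearr (l : dual h) : linear (form l : dual h -> K^o).
Proof. by move=> c m n; rewrite /form !linearP; apply: killing_linearr. Qed.

End FormTheory.

Section TensorCrystal.
Context (K : numFieldType) (g : lieAlgebra K) (h : {vspace g}).
Context (Pi : {fset dual h}) (om : Pi -> dual h).
Context (omP : is_fundamental_weights om).
Implicit Types (B : crystal om) (a : Pi).

Lemma pairing_unique (a l : dual h) (n : int) :
  n%:~R = form (coroot a) l -> pairing a l = n.
Proof.
move=> e; rewrite /pairing; case: xgetP => [m _ /= em|H].
- by apply: (@intr_inj K); rewrite em.
- by case: (H n).
Qed.

Lemma form_coroot (a : dual h) l : form (coroot a) l = 2%:R / form a a * form a l.
Proof.
rewrite formC.
have := form_linearr l (2%:R / form a a) a 0.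
rewrite addr0 => ->.
have := form_linearr l 1 0 0; rewrite scaler0 addr0 scale1r => e.
have -> : form l 0 = 0 by apply: (addrI (form l 0)); rewrite addr0 -e.
by rewrite addr0 formC.
Qed.

Lemma form_corootD (a l m : dual h) :
  form (coroot a) (l + m) = form (coroot a) l + form (coroot a) m.
Proof. by have := form_linearr (coroot a) 1 l m; rewrite !scale1r. Qed.

Lemma form_coroot0 (a : dual h) : form (coroot a) 0 = 0.
Proof.
by apply: (addrI (form (coroot a) 0)); rewrite addr0 -form_corootD addr0.
Qed.

Lemma form_corootN (a l : dual h) : form (coroot a) (- l) = - form (coroot a) l.
Proof.
by apply: (addrI (form (coroot a) l)); rewrite -form_corootD !subrr form_coroot0.
Qed.

Lemma form_corootMn (a l : dual h) n :
  form (coroot a) (l *+ n) = form (coroot a) l *+ n.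
Proof.
elim: n => [|n IH]; first by rewrite !mulr0n form_coroot0.
by rewrite !mulrS form_corootD IH.
Qed.

Lemma form_corootMz (a l : dual h) (n : int) :
  form (coroot a) (l *~ n) = form (coroot a) l *~ n.
Proof.
case: n => n; first exact: form_corootMn.
by rewrite !NegzE !mulrNz form_corootN form_corootMn.
Qed.

Lemma pairing_lattice a l : weight_lattice om l ->
  (pairing (val a) l)%:~R = form (coroot (val a)) l.
Proof.
move=> [n ->].
suff [m em] : exists m : int,
    m%:~R = form (coroot (val a)) (\sum_(b : Pi) om b *~ n b).
  by rewrite (pairing_unique em).
elim/big_ind: _ => [|l1 l2 [m1 e1] [m2 e2]|b _].
- by exists 0; rewrite form_coroot0.
- by exists (m1 + m2); rewrite form_corootD rmorphD /= e1 e2.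
- rewrite form_corootMz form_coroot formC omP.
  have [e|ne] := eqVneq (form (val a) (val a)) 0.
    by exists 0; rewrite e invr0 mulr0 !mul0r mul0rz.
  exists ((b == a)%:R * n b); rewrite rmorphM /= mulrzr; congr (_ *~ _).
  have two : (2%:R : K) != 0 by rewrite pnatr_eq0.
  rewrite rmorph_nat mulrCA; case: (b == a); last by rewrite !mul0r.
  by rewrite !mul1r mulrA mulfVK // divff.
Qed.

Lemma pairingD a l m : weight_lattice om l -> weight_lattice om m ->
  pairing (val a) (l + m) = pairing (val a) l + pairing (val a) m.
Proof.
move=> Hl Hm; apply: pairing_unique.
by rewrite rmorphD /= !pairing_lattice // form_corootD.
Qed.

Lemma weight_latticeD (l m : dual h) : weight_lattice om l ->
  weight_lattice om m -> weight_lattice om (l + m).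
Proof.
move=> [n1 ->] [n2 ->]; exists (fun b => n1 b + n2 b).
by rewrite -big_split /=; apply: eq_bigr => b _; rewrite mulrzDr.
Qed.

Section Def.
Context (B1 B2 : crystal om).
Implicit Types b : (B1 * B2)%type.

Definition tens_wt b := wt b.1 + wt b.2.

Definition tens_eps a b : zinf :=
  zmax (eps a b.1) (zadd (eps a b.2) (- pairing (val a) (wt b.1))).

Definition tens_phi a b : zinf :=
  zmax (phi a b.2) (zadd (phi a b.1) (pairing (val a) (wt b.2))).

Definition tens_E a b : option (B1 * B2) :=
  if zle (eps a b.2) (phi a b.1) then otens (cE a b.1) (Some b.2)
  else otens (Some b.1) (cE a b.2).

Definition tens_F a b : option (B1 * B2) :=
  if zlt (eps a b.2) (phi a b.1) then otens (cF a b.1) (Some b.2)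
  else otens (Some b.1) (cF a b.2).

Lemma tens_wt_lattice b : weight_lattice om (tens_wt b).
Proof. by apply: weight_latticeD; apply: wt_lattice. Qed.

Lemma tens_phiE a b :
  tens_phi a b = zadd (tens_eps a b) (pairing (val a) (tens_wt b)).
Proof.
case: b => b1 b2; rewrite /tens_phi /tens_eps /tens_wt /=.
rewrite pairingD; [|exact: wt_lattice..].
rewrite !phiE; case: (eps a b1) (eps a b2) => [e1|] [e2|] //=.
- rewrite /zmax /=; case: ifP => H1; case: ifP => H2 /=; congr Some; lia.
- by congr Some; lia.
- by congr Some; lia.
Qed.

Lemma cE_fin B a (b b' : B) : cE a b = Some b' -> exists e p : int,
  [/\ eps a b = Some e, phi a b = Some p, eps a b' = Some (e - 1),
      phi a b' = Some (p + 1) & wt b' = wt b + val a].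
Proof.
move=> H; have [-> -> ->] := cE_some H.
case Ep: (phi a b) => [p|]; last by have [] := phi_infty Ep; rewrite H.
by move: Ep; rewrite phiE; case: (eps a b) => //= e _; exists e, p.
Qed.

Lemma cF_fin B a (b b' : B) : cF a b = Some b' -> exists e p : int,
  [/\ eps a b = Some e, phi a b = Some p, eps a b' = Some (e + 1),
      phi a b' = Some (p - 1) & wt b' = wt b - val a].
Proof.
move=> H; have [-> -> ->] := cF_some H.
case Ep: (phi a b) => [p|]; last by have [_] := phi_infty Ep; rewrite H.
by move: Ep; rewrite phiE; case: (eps a b) => //= e _; exists e, p.
Qed.

Lemma pairing_same B a (b b' : B) : cE a b = Some b' ->
  pairing (val a) (wt b') = pairing (val a) (wt b) + 2.
Proof.
move=> H; have [e [p [E1 P1 E2 P2 _]]] := cE_fin H.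
have := phiE a b; have := phiE a b'.
by rewrite E1 P1 E2 P2 /= => -[e1] [e2]; lia.
Qed.

Lemma tens_FE a b b' : tens_F a b = Some b' <-> tens_E a b' = Some b.
Proof.
case: b b' => [b1 b2] [c1 c2]; rewrite /tens_F /tens_E /zlt /=; split.
- case: ifP => /= H.
    case E: (cF a b1) => [d|] //= [<- <-].
    have [e [p [E1 P1 E2 P2 _]]] := cF_fin E.
    move: E H => /cFE ->; rewrite P2 P1; case: (eps a b2) => [n|] //= H.
    by rewrite ifT //; lia.
  case E: (cF a b2) => [d|] //= [<- <-].
  have [e [p [E1 P1 E2 P2 _]]] := cF_fin E.
  move: E H => /cFE ->; rewrite E2 E1; case: (phi a b1) => [n|] //= H.
  by rewrite ifF //; lia.
- case: ifP => /= H.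
    case E: (cE a c1) => [d|] //= [<- <-].
    have [e [p [E1 P1 E2 P2 _]]] := cE_fin E.
    move: E H => /cFE ->; rewrite P2 P1; case: (eps a c2) => [n|] //= H.
    by rewrite ifT //; lia.
  case E: (cE a c2) => [d|] //= [<- <-].
  have [e [p [E1 P1 E2 P2 _]]] := cE_fin E.
  move: E H => /cFE ->; rewrite E2 E1; case: (phi a c1) => [n|] //= H.
  by rewrite ifF //; lia.
Qed.

Lemma tens_phi_infty a b : tens_phi a b = None ->
  tens_E a b = None /\ tens_F a b = None.
Proof.
case: b => b1 b2; rewrite /tens_phi /tens_E /tens_F /=.
case P1: (phi a b1) => [p1|]; case P2: (phi a b2) => [p2|]; rewrite /zmax //=.
  by case: ifP.
move=> _; have [EE _] := phi_infty P1; have [-> ->] := phi_infty P2.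
by rewrite EE /= !if_same.
Qed.

Lemma tens_E_some a b b' : tens_E a b = Some b' ->
  [/\ tens_eps a b' = zadd (tens_eps a b) (-1),
      tens_phi a b' = zadd (tens_phi a b) 1
    & tens_wt b' = tens_wt b + val a].
Proof.
move=> HE.
case: b b' HE => [b1 b2] [c1 c2]; rewrite /tens_E /=.
have F1 := phiE a b1; have F2 := phiE a b2; case: ifP => /= H.
  case E: (cE a b1) => [d|] //= [<- <-].
  have W := pairing_same E; have [e [p [E1 P1 E2 P2 Wd]]] := cE_fin E.
  rewrite /tens_eps /tens_phi /tens_wt /= W E1 P1 E2 P2 Wd.
  move: F1 F2 H; rewrite E1 P1 => -[F1].
  case: (eps a b2) => [n|] /= F2; rewrite ?F2 /zmax /= => H; split;
    rewrite 1?addrAC //; do ?[case: ifP => ? /=]; congr Some; lia.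
case E: (cE a b2) => [d|] //= [<- <-].
have W := pairing_same E; have [e [p [E1 P1 E2 P2 Wd]]] := cE_fin E.
rewrite /tens_eps /tens_phi /tens_wt /= W E1 P1 E2 P2 Wd.
move: F1 F2 H; rewrite E1 P1 => F1 -[F2].
move: F1; case: (eps a b1) => [n|] /= F1; rewrite ?F1 /zmax /= => H; split;
  rewrite ?addrA //; do ?[case: ifP => ? /=]; congr Some; lia.
Qed.

Lemma tens_F_some a b b' : tens_F a b = Some b' ->
  [/\ tens_eps a b' = zadd (tens_eps a b) 1,
      tens_phi a b' = zadd (tens_phi a b) (-1)
    & tens_wt b' = tens_wt b - val a].
Proof.
move=> /tens_FE /tens_E_some [-> -> ->].
split; last by rewrite addrK.
- by case: (tens_eps a b') => //= n; rewrite subrK.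
- by case: (tens_phi a b') => //= n; rewrite addrK.
Qed.

Definition crys_tensor : crystal om :=
  Crystal tens_wt_lattice tens_phiE tens_FE tens_phi_infty
    tens_E_some tens_F_some.

End Def.

Section Mor.
Context (B1 B1' B2 B2' : crystal om).
Context (f1 : crys_mor B1 B1') (f2 : crys_mor B2 B2').

Definition tens_mor (x : option (B1 * B2)) : option (B1' * B2') :=
  obind (fun b => otens (f1 (Some b.1)) (f2 (Some b.2))) x.

Lemma tens_mor_otens x y :
  tens_mor (otens x y) = otens (f1 x) (f2 y).
Proof.
have [z1 _ _ _] := morP f1; have [z2 _ _ _] := morP f2.
case: x y => [x|] [y|] //=; rewrite ?z1 ?z2 //.
by case: (f1 _).
Qed.

Lemma tens_morP :
  @is_crys_mor _ _ _ _ om (crys_tensor B1 B2) (crys_tensor B1' B2') tens_mor.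
Proof.
have [z1 s1 e1 k1] := morP f1; have [z2 s2 e2 k2] := morP f2.
split=> //.
- move=> [b1 b2] [c1 c2] /=.
  case M1: (f1 (Some b1)) => [d1|] //; case M2: (f2 (Some b2)) => [d2|] //=.
  move=> [<- <-]; have [w1 t1] := s1 _ _ M1; have [w2 t2] := s2 _ _ M2.
  rewrite /tens_wt /= w1 w2; split=> // a.
  by rewrite /tens_eps /tens_phi /= w1 w2; have [-> ->] := t1 a; have [-> ->] := t2 a.
- move=> a [b1 b2] /=.
  case M1: (f1 (Some b1)) => [d1|] //; case M2: (f2 (Some b2)) => [d2|] //=.
  rewrite /tens_E /=.
  have [_ /(_ a) [-> p1]] := s2 _ _ M2; have [_ /(_ a) [q1 ->]] := s1 _ _ M1.
  case: ifP => _; rewrite tens_mor_otens ?M1 ?M2 => H _.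
    by rewrite e1 ?M1 // => E; rewrite E in H.
  by rewrite e2 ?M2 // => E; rewrite E in H.
- move=> a [b1 b2] /=.
  case M1: (f1 (Some b1)) => [d1|] //; case M2: (f2 (Some b2)) => [d2|] //=.
  rewrite /tens_F /=.
  have [_ /(_ a) [-> p1]] := s2 _ _ M2; have [_ /(_ a) [q1 ->]] := s1 _ _ M1.
  case: ifP => _; rewrite tens_mor_otens ?M1 ?M2 => H _.
    by rewrite k1 ?M1 // => E; rewrite E in H.
  by rewrite k2 ?M2 // => E; rewrite E in H.
Qed.

Definition crys_tensor_mor
  : crys_mor (crys_tensor B1 B2) (crys_tensor B1' B2') := CrysMor tens_morP.

End Mor.
End TensorCrystal.

Section TensorFunctor.
Context (K : numFieldType) (g : lieAlgebra K) (h : {vspace g}).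
Context (Pi : {fset dual h}) (om : Pi -> dual h).
Context (omP : is_fundamental_weights om).

Definition tensor_ob (B1 B2 : Crys om) : Crys om := crys_tensor omP B1 B2.

Definition tensor_hom (B1 B1' B2 B2' : Crys om)
    (f1 : hom B1 B1') (f2 : hom B2 B2')
  : hom (tensor_ob B1 B2) (tensor_ob B1' B2') :=
  crys_tensor_mor omP f1 f2.

End TensorFunctor.

(* Main.v *)
(* The associator is the rebracketing bijection: both bracketings apply E_alpha
   to the same factor, a comparison of the integers phi_alpha(b_i), eps_alpha(b_i)
   and (alpha^vee, wt b_i).  The unit is a single element of weight 0 with
   eps_alpha = phi_alpha = -oo; with the value 0 instead, eps_alpha(1 (x) b) would
   be max(0, eps_alpha(b)), so 1 would not be a unit. *)
Require Import Defs.
From mathcomp Require Import all_boot all_order all_algebra finmap.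
From mathcomp Require Import reals complex.
From mathcomp Require Import zify.

Set Implicit Arguments.
Unset Strict Implicit.
Unset Printing Implicit Defensive.

Import Order.TTheory GRing.Theory Num.Theory.
Local Open Scope ring_scope.

Section CrystalBijection.
Context (K : fieldType) (g : lieAlgebra K) (h : {vspace g}).
Context (Pi : {fset dual h}) (om : Pi -> dual h).
Context (B1 B2 : crystal om) (f : B1 -> B2) (f' : B2 -> B1).

(* Axioms (1) and (2) force phi and F to be preserved as well. *)
Record crys_bij : Prop := CrysBij {
  bijK : cancel f f';
  bijVK : cancel f' f;
  bij_wt : forall b, wt (f b) = wt b;
  bij_eps : forall a b, eps a (f b) = eps a b;
  bij_E : forall a b, cE a (f b) = omap f (cE a b)
}.

Context (fP : crys_bij).

Lemma bij_phi a b : phi a (f b) = phi a b.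
Proof. by rewrite !phiE (bij_wt fP) (bij_eps fP). Qed.

Lemma bij_F a b : cF a (f b) = omap f (cF a b).
Proof.
case Ffb: (cF a (f b)) => [c|].
  (* Axiom (2) gives E c = f b. With c written as [f (f' c)], injectivity of [f] pulls this back to
     E (f' c) = b. *)
  have := iffLR (cFE _ _ _) Ffb; rewrite -[c](bijVK fP) (bij_E fP).
  case Ec: (cE a (f' c)) => [b'|] //= -[/(can_inj (bijK fP)) eb].
  by move: Ec; rewrite eb => /cFE ->.
case Fb: (cF a b) => [c|] //=.
have := iffLR (cFE _ _ _) Fb => Ec.
suff /cFE : cE a (f c) = Some (f b) by rewrite Ffb.
by rewrite (bij_E fP) Ec.
Qed.

Lemma bij_mor_subproof : @is_crys_mor _ _ _ _ om B1 B2 (omap f).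
Proof.
split=> //= [b _ [<-]|a b _ _|a b _ _].
- by rewrite (bij_wt fP); split=> // a; rewrite (bij_eps fP) bij_phi.
- by rewrite (bij_E fP).
- by rewrite bij_F.
Qed.

Definition bij_mor : crys_mor B1 B2 := CrysMor bij_mor_subproof.

End CrystalBijection.

Section CrystalIsomorphism.
Context (K : fieldType) (g : lieAlgebra K) (h : {vspace g}).
Context (Pi : {fset dual h}) (om : Pi -> dual h).
Context (B1 B2 : crystal om) (f : B1 -> B2) (f' : B2 -> B1).

Lemma crys_bijV : crys_bij f f' -> crys_bij f' f.
Proof.
case=> fK f'K fw fe fE; split=> // [b|a b|a b].
- by rewrite -fw f'K.
- by rewrite -fe f'K.
- rewrite -[in RHS](f'K b) fE; case: (cE a (f' b)) => //= c.
  by rewrite fK.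
Qed.

Lemma bij_mor_iso (fP : crys_bij f f') :
  is_iso (C := Crys om) (bij_mor fP).
Proof.
exists (bij_mor (crys_bijV fP)); apply: crys_mor_eq => -[b|] //=.
- by rewrite (bijK fP).
- by rewrite (bijVK fP).
Qed.

End CrystalIsomorphism.

Section MonoidalCrystals.
Context (K : numFieldType) (g : lieAlgebra K) (h : {vspace g}).
Context (Pi : {fset dual h}) (om : Pi -> dual h).
Context (omP : is_fundamental_weights om).
Implicit Types (X Y Z W : crystal om).

Local Notation "X ⊗ Y" := (crys_tensor omP X Y) (at level 40).

Lemma pairing0 (a : dual h) : pairing a 0 = 0.
Proof. by apply: pairing_unique; rewrite form_coroot0. Qed.

Lemma weight_lattice0 : weight_lattice om 0.
Proof. by exists (fun=> 0); rewrite big1. Qed.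

(** Since phi is -oo, axiom (3) forces both operators to be 0. Kept transparent so that the unit
    laws can compute with its fields. *)
Definition crys_unit : crystal om.
Proof.
by refine (@Crystal _ _ _ _ om unit (fun=> 0) (fun _ _ => None)
  (fun _ _ => None) (fun _ _ => None) (fun _ _ => None) _ _ _ _ _ _) => // _;
  exact: weight_lattice0.
Defined.

Lemma zadd0 x : zadd x 0 = x.
Proof. by case: x => //= n; rewrite addr0. Qed.

Lemma zmaxNoo x : zmax x None = x.
Proof. by case: x. Qed.

(** Puts finite maxima in a form that [lia] handles. *)
Lemma zmax_Some m n : zmax (Some m) (Some n) = Some (Num.max m n).
Proof. by rewrite /zmax /= -(fun_if Some) maxElt; case: ltgtP => // ->. Qed.

Lemma lunit_bij X :
  @crys_bij _ _ _ _ om (crys_unit ⊗ X) X snd (pair (tt : crys_unit)).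
Proof.
split=> //= [[[] b] //|[[] b]|a [[] b]|a [[] b]] /=.
- by rewrite /tens_wt add0r.
- by rewrite /tens_eps /= pairing0 oppr0 zadd0.
(* If eps b is finite, it exceeds phi = -oo of the unit, so E acts on b. If eps b = -oo, the tie
   sends E to the unit, giving 0, and E b = 0 by axiom (3). *)
- rewrite /tens_E /=; case eb: (eps a b) => /=; first by case: (cE a b).
  have phib : phi a b = None by rewrite phiE eb.
  by case: (phi_infty phib).
Qed.

Lemma runit_bij X :
  @crys_bij _ _ _ _ om (X ⊗ crys_unit) X fst (pair^~ (tt : crys_unit)).
Proof.
split=> //= [[b []] //|[b []]|a [b []]|a [b []]] /=.
- by rewrite /tens_wt addr0.
- by rewrite /tens_eps /= zmaxNoo.
(* The unit has eps = -oo, so E always acts on the left factor. *)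
- by rewrite /tens_E /=; case: (cE a b).
Qed.

Definition rebracket (T1 T2 T3 : Type) (b : T1 * T2 * T3) : T1 * (T2 * T3) :=
  (b.1.1, (b.1.2, b.2)).

Definition unbracket (T1 T2 T3 : Type) (b : T1 * (T2 * T3)) : T1 * T2 * T3 :=
  (b.1, b.2.1, b.2.2).

Lemma assoc_bij X Y Z :
  @crys_bij _ _ _ _ om ((X ⊗ Y) ⊗ Z) (X ⊗ (Y ⊗ Z))
    (@rebracket X Y Z) (@unbracket X Y Z).
Proof.
split=> //= [[[x y] z] //|[x [y z]] //|[[x y] z]|a [[x y] z]|a [[x y] z]];
  rewrite /rebracket /=.
- by rewrite /tens_wt /= addrA.
- rewrite /tens_eps /= /tens_eps /tens_wt /=.
  (* With p the pairing of the coroot with the weight, both sides are the maximum of eps x, eps y -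
     p x and eps z - p x - p y. *)
  rewrite (pairingD omP); [|exact: wt_lattice..].
  case: (eps a x) (eps a y) (eps a z) => [ex|] [ey|] [ez|] //=;
    rewrite ?zmaxNoo ?zmax_Some //=; congr Some; lia.
- rewrite /tens_E /= /tens_phi /tens_eps /tens_E /=.
  (* In both bracketings E acts on x iff phi x >= eps y and phi x + p y >= eps z, on y iff phi x <
     eps y and phi y >= eps z, and otherwise on z. Branches where the two sides disagree are
     contradictory. *)
  rewrite (phiE a x) (phiE a y).
  case: (eps a x) => [ex|]; case: (eps a y) => [ey|];
    case: (eps a z) => [ez|] /=; rewrite ?zmaxNoo ?zmax_Some /=;
    repeat (case: ifP => /= ?); case: (cE a x) => [x'|] //=;
    case: (cE a y) => [y'|] //=; case: (cE a z) => [z'|] //=; lia.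
Qed.

(** The structure maps send no element to 0, so pentagon and triangle hold by evaluation on pure
    tensors; naturality must also treat morphisms that send a factor to 0. *)
Lemma crys_monoidal :
  monoidal_structure (C := Crys om) (tob := tensor_ob omP) (tensor_hom omP).
Proof.
refine (@MonoidalStructure (Crys om) (tensor_ob omP) (@tensor_hom _ _ _ _ _ omP)
  _ _ crys_unit (fun X Y Z => bij_mor (assoc_bij X Y Z))
  (fun X => bij_mor (lunit_bij X)) (fun X => bij_mor (runit_bij X))
  (fun X Y Z => bij_mor_iso _) (fun X => bij_mor_iso _)
  (fun X => bij_mor_iso _) _ _ _ _ _).
- by move=> X Y; apply: crys_mor_eq => -[[x y]|].
- move=> X X' X'' Y Y' Y'' u' u v' v; apply: crys_mor_eq => -[[x y]|] //=.
  by rewrite tens_mor_otens.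
- move=> X X' Y Y' Z Z' u v w; apply: crys_mor_eq => -[[[x y] z]|] //=.
  by case: (u (Some x)) (v (Some y)) (w (Some z)) => [?|] [?|] [?|].
- move=> X X' u; apply: crys_mor_eq => -[[[] x]|] /=.
  + by case: (u (Some x)).
  + by rewrite (mor0 (morP u)).
- move=> X X' u; apply: crys_mor_eq => -[[x []]|] /=.
  + by case: (u (Some x)).
  + by rewrite (mor0 (morP u)).
- by move=> W X Y Z; apply: crys_mor_eq => -[[[[w x] y] z]|].
- by move=> X Y; apply: crys_mor_eq => -[[[x []] y]|].
Qed.

End MonoidalCrystals.

Theorem proposition7p1p7 (R : realType)
    (g : lieAlgebra (complex R)) (ss : semisimple g)
    (h : {vspace g}) (hC : is_cartan h)
    (Pi : {fset dual h}) (PiP : is_simple_roots Pi)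
    (om : Pi -> dual h) (omP : is_fundamental_weights om) :
  inhabited (monoidal_structure (C := Crys om) (tob := tensor_ob omP)
    (tensor_hom omP)).
Proof. exact/inhabits/crys_monoidal. Qed.
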